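(* Let $m,n$ be positive integers, let $A\in\mathcal{M}_{n,m}(\mathbb{F}_q((z^{-1})))$ and $\underline{\theta}\in\mathbb{F}_q((z^{-1}))^n$. Then $$\omega(A,\underline{\theta})\ge\frac{1}{\widehat{\omega}(A^T)}\quad\text{and}\quad\widehat{\omega}(A,\underline{\theta})\ge\frac{1}{\omega(A^T)},$$ and both of these inequalities are equalities for almost all $\underline{\theta}\in\mathbb{F}_q((z^{-1}))^n$ with respect to the Haar measure on $\mathbb{F}_q((z^{-1}))^n$. Moreover, if $\underline{\theta}\notin A\mathbb{F}_q[z]^m+\mathbb{F}_q[z]^n$, then $\widehat{\omega}(A,\underline{\theta})\le\omega(A)$.
   Context: Let $q$ be a prime power, $\mathbb{F}_q$ the field with $q$ elements, $\mathbb{F}_q[z]$ the polynomial ring and $\mathbb{F}_q((z^{-1}))$ the field of formal Laurent series $x=\sum_{i\ge -N}a_iz^{-i}$. For nonzero $x$, $\|x\|=q^{\deg x}$ where $\deg x$ is the largest $d$ with nonzero coefficient of $z^d$; $\|0\|=0$. For a vector $\underline{v}$, $\|\underline{v}\|$ is the maximum norm of its coordinates and $|\langle\underline{v}\rangle|=\min_{\underline{y}\text{ polynomial vector}}\|\underline{v}-\underline{y}\|$. For $A\in\mathcal{M}_{n,m}(\mathbb{F}_q((z^{-1})))$ and $\underline{\theta}\in\mathbb{F}_q((z^{-1}))^n$: $\omega(A,\underline{\theta})$ is the supremum of real $\omega$ such that for arbitrarily large real $H$ the system $|\langle A\underline{x}-\underline{\theta}\rangle|\le H^{-\omega}$, $\|\underline{x}\|\le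 H$ has a solution $\underline{x}\in\mathbb{F}_q[z]^m$; $\widehat{\omega}(A,\underline{\theta})$ is the supremum of real $\omega$ such that this system has a solution for all sufficiently large real $H$. The homogeneous exponents $\omega(A)$ and $\widehat{\omega}(A)$ are defined in the same way with $\underline{\theta}=\underline{0}$ and requiring the solution $\underline{x}$ to be nonzero. The same definitions apply to the transposed matrix $A^T\in\mathcal{M}_{m,n}$ (with $\underline{x}\in\mathbb{F}_q[z]^n$). These exponents may equal $+\infty$, and $1/(+\infty)$ is understood to be $0$. *)

(* Defs.v *)
From HB Require Import structures.
From mathcomp Require Import all_boot all_order all_algebra.
From mathcomp Require Import all_classical all_reals all_analysis.
From mathcomp Require Import zify ring.

Set Implicit Arguments.
Unset Strict Implicit.
Unset Printing Implicit Defensive.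

Import Order.TTheory GRing.Theory Num.Theory.

Local Open Scope classical_set_scope.
Local Open Scope ring_scope.

(* A formal Laurent series in z^-1 over F is a function d |-> coefficient of
   z^d which vanishes for all large enough d. *)
Section LaurentZmodule.
Variable F : fieldType.
Implicit Types (f g : int -> F) (N d : int).

Definition deg_le f N := forall d, N < d -> f d = 0.

Definition lbounded : {pred int -> F} := [pred f | `[< exists N, deg_le f N >]].

Record laurent := Laurent {
  lcoef :> int -> F;
  lcoef_bounded : lcoef \in lbounded }.

HB.instance Definition _ := [isSub for lcoef].
HB.instance Definition _ := [Choice of laurent by <:].

Lemma lboundedP f : reflect (exists N, deg_le f N) (f \in lbounded).
Proof. by rewrite inE; apply: asboolP. Qed.

Lemma lbounded_zmod_closed : zmod_closed lbounded.
Proof.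
split; first by apply/lboundedP; exists 0.
move=> f g /lboundedP [N fN] /lboundedP [M gM]; apply/lboundedP.
exists (Order.max N M) => d; rewrite gt_max => /andP [Nd Md].
by rewrite -[LHS]/(f d - g d) fN// gM// subr0.
Qed.

HB.instance Definition _ :=
  GRing.isZmodClosed.Build (int -> F) lbounded lbounded_zmod_closed.
HB.instance Definition _ := [SubChoice_isSubZmodule of laurent by <:].

End LaurentZmodule.

Section LaurentField.
Variable F : fieldType.
Implicit Types (f g h : int -> F) (x y : laurent F) (N M L d : int) (k : nat).

Lemma laurentP x y : x =1 y <-> x = y.
Proof. by split=> [/funext e|->//]; apply: val_inj. Qed.

Lemma lcoefD x y d : (x + y) d = x d + y d. Proof. by []. Qed.
Lemma lcoefN x d : (- x) d = - x d. Proof. by []. Qed.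
Lemma lcoef0 d : (0 : laurent F) d = 0. Proof. by []. Qed.

Lemma laurent_deg_le x : exists N, deg_le x N.
Proof. exact/lboundedP/lcoef_bounded. Qed.

Lemma deg_leW f N M : N <= M -> deg_le f N -> deg_le f M.
Proof. by move=> NM fN d Md; apply: fN; apply: le_lt_trans Md. Qed.

Lemma int_below N d : N < d \/ exists k, d = N - k%:Z.
Proof.
case: (ltP N d) => [|dN]; [by left|right].
by exists `|N - d|%N; rewrite gez0_abs ?subr_ge0// opprB addrC subrK.
Qed.

Definition convol f g d : F := \sum_(i \in [set: int]) f i * g (d - i).

Lemma convol_coef N M f g k : deg_le f N -> deg_le g M ->
  convol f g (N + M - k%:Z) =
  \sum_(j < k.+1) f (N - j%:Z) * g (M - (k - j)%N%:Z).
Proof.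
move=> fN gM.
pose r := [seq N - j%:Z | j <- iota 0 k.+1].
have r_uniq : uniq r.
  by rewrite map_inj_uniq ?iota_uniq// => i j /addrI /oppr_inj [].
rewrite /convol -(@fsbig_widen _ _ _ _ [set` r]) //; last first.
  move=> i [_ /= ir]; have [Ni|[j ij]] := int_below N i; first by rewrite fN ?mul0r.
  rewrite gM ?mulr0// ij.
  have kj : (k < j)%N.
    rewrite ltnNge; apply/negP => jk; apply: ir; rewrite ij.
    by apply: (map_f (fun j : nat => N - j%:Z)); rewrite mem_iota.
  rewrite (_ : N + M - k%:Z - (N - j%:Z) = M + (j%:Z - k%:Z)); last by ring.
  by rewrite ltrDl subr_gt0 ltz_nat.
rewrite -fsbig_seq// big_map -[iota _ _]/(index_iota 0 k.+1) big_mkord.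
apply: eq_bigr => j _; congr (_ * g _).
rewrite -subzn; last by rewrite -ltnS.
by ring.
Qed.

Lemma convol_deg_le N M f g :
  deg_le f N -> deg_le g M -> deg_le (convol f g) (N + M).
Proof.
move=> fN gM d NMd; rewrite /convol fsbig1// => i _.
have [Ni|iN] := ltP N i; first by rewrite fN ?mul0r.
by rewrite gM ?mulr0//; lia.
Qed.

Fact mull_subproof x y : convol x y \in @lbounded F.
Proof.
have [N xN] := laurent_deg_le x; have [M yM] := laurent_deg_le y.
by apply/lboundedP; exists (N + M); apply: convol_deg_le.
Qed.
Definition mull x y := Laurent (mull_subproof x y).

Fact onel_subproof : (fun d => (d == 0)%:R) \in @lbounded F.
Proof. by apply/lboundedP; exists 0 => d; rewrite lt_def => /andP[/negPf->]. Qed.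
Definition onel := Laurent onel_subproof.

Let tr N k f : {poly F} := \poly_(j < k.+1) f (N - j%:Z).

Let convol_tr N M f g k l : deg_le f N -> deg_le g M -> (l <= k)%N ->
  convol f g (N + M - l%:Z) = (tr N k f * tr M k g)`_l.
Proof.
move=> fN gM lk; rewrite (convol_coef _ fN gM) coefM; apply: eq_bigr => j _.
by rewrite !coef_poly !ltnS (leq_trans (leq_subr _ _) lk)
  (leq_trans _ lk)// -ltnS.
Qed.

Fact mullC : commutative mull.
Proof.
move=> x y; have [N xN] := laurent_deg_le x; have [M yM] := laurent_deg_le y.
apply/laurentP => d; have [NMd|[k ->]] := int_below (N + M) d.
  rewrite /= (convol_deg_le xN yM NMd) (convol_deg_le yM xN)//.
  by rewrite addrC.
by rewrite /= (convol_tr xN yM (leqnn k)) mulrC -(convol_tr yM xN (leqnn k)) (addrC N).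
Qed.

Fact mullA : associative mull.
Proof.
move=> x y w; have [N xN] := laurent_deg_le x.
have [M yM] := laurent_deg_le y; have [L wL] := laurent_deg_le w.
have xyN := convol_deg_le xN yM; have ywN := convol_deg_le yM wL.
apply/laurentP => d; have [NMd|[k ->]] := int_below (N + M + L) d.
  rewrite /= (convol_deg_le xyN wL)//.
  by rewrite (convol_deg_le xN ywN)// addrA.
rewrite /= (convol_tr xyN wL (leqnn k)) -(addrA N) (convol_tr xN ywN (leqnn k)).
have eqtr (p q : {poly F}) : (forall l, (l <= k)%N -> p`_l = q`_l) ->
    forall s, (p * s)`_k = (q * s)`_k.
  by move=> pq s; rewrite !coefM; apply: eq_bigr => j _; rewrite pq// -ltnS.
transitivity (tr N k x * (tr M k y * tr L k w))`_k.
  rewrite [in LHS]mulrC [in RHS]mulrC; apply: eqtr => l lk.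
  by rewrite coef_poly ltnS lk /= (convol_tr yM wL lk).
rewrite mulrA; apply: eqtr => l lk.
by rewrite coef_poly ltnS lk /= (convol_tr xN yM lk).
Qed.

Fact mul1l : left_id onel mull.
Proof.
move=> x; apply/laurentP => d /=.
rewrite /convol -(@fsbig_widen _ _ _ _ [set 0]) //; last first.
  by move=> i [_ /= /eqP/negPf ->]; rewrite mul0r.
by rewrite fsbig_set1 eqxx mul1r subr0.
Qed.

Fact mullDl : left_distributive mull +%R.
Proof.
move=> x y w; have [L wL] := laurent_deg_le w.
have [N0 xN0] := laurent_deg_le x; have [M0 yM0] := laurent_deg_le y.
pose N := Order.max N0 M0.
have xN : deg_le x N by apply: deg_leW xN0; rewrite le_max lexx.
have yN : deg_le y N by apply: deg_leW yM0; rewrite le_max lexx orbT.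
have xyN : deg_le (x + y) N by move=> d Nd; rewrite lcoefD xN// yN// addr0.
apply/laurentP => d; rewrite lcoefD /=.
have [NMd|[k ->]] := int_below (N + L) d.
  by rewrite !(convol_deg_le _ wL NMd)// addr0.
rewrite !(convol_coef _ _ wL)// -big_split; apply: eq_bigr => j _.
exact: mulrDl.
Qed.

Fact onel_neq0 : onel != 0.
Proof.
by apply/eqP => /(congr1 (fun x : laurent F => x 0))/eqP; rewrite /= oner_eq0.
Qed.

HB.instance Definition _ := GRing.Zmodule_isComNzRing.Build (laurent F)
  mullA mullC mul1l mullDl onel_neq0.

Lemma lcoefM x y d : (x * y) d = \sum_(i \in [set: int]) x i * y (d - i).
Proof. by []. Qed.

Lemma lcoef1 d : (1 : laurent F) d = (d == 0)%:R. Proof. by []. Qed.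

(* Meaningful only for x != 0, see ldegP; ldeg 0 is a junk value. *)
Definition ldeg x : int := xget 0 [set d | x d != 0 /\ deg_le x d].

Lemma ldegP x : x != 0 -> x (ldeg x) != 0 /\ deg_le x (ldeg x).
Proof.
move=> x0; suff : exists d, x d != 0 /\ deg_le x d by apply: xgetPex.
have [N xN] := laurent_deg_le x.
have exk : exists k, x (N - k%:Z) != 0.
  apply: contrapT => nk; move/eqP: x0; apply; apply/laurentP => d.
  have [/xN//|[k ->]] := int_below N d.
  by apply/eqP; apply: contra_notT nk => nk; exists k.
case: (ex_minnP exk) => k xk kmin; exists (N - k%:Z); split=> // d kd.
have [/xN//|[j dj]] := int_below N d; apply/eqP; apply: contraTT kd => xd.
by rewrite dj in xd *; have := kmin _ xd; rewrite -leNgt lerD2l lerN2 lez_nat.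
Qed.

Let invs (a : F) (f : nat -> F) : nat -> seq F :=
  fix invs k := if k is k'.+1 then
    rcons (invs k') (- a^-1 * \sum_(j < k) f (k - j)%N * (invs k')`_j)
  else [:: a^-1].

Fact laurent_inv_subproof x : x != 0 -> exists y, y * x = 1.
Proof.
move=> /ldegP; set N := ldeg x; set a := x N => -[a0 xN].
pose s := invs a (fun j => x (N - j%:Z)).
have size_s k : size (s k) = k.+1 by elim: k => // k IH; rewrite /= size_rcons IH.
have s_stable j k : (j <= k)%N -> (s k)`_j = (s j)`_j.
  move=> /subnK <-; elim: (k - j)%N => // i IH.
  by rewrite addSn /= nth_rcons size_s ltnS leq_addl IH.
pose g d := if d <= - N then (s `|- N - d|%N)`_`|- N - d|%N else 0.
have gN : deg_le g (- N) by move=> d Nd; rewrite /g leNgt Nd.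
have gb : g \in @lbounded F by apply/lboundedP; exists (- N).
have gE k : g (- N - k%:Z) = (s k)`_k.
  by rewrite /g lerBlDr lerDl lez_nat leq0n opprB addrC subrK absz_nat.
exists (Laurent gb); rewrite mulrC; apply/laurentP => d /=.
have [|[k dk]] := int_below (N + - N) d.
  by move=> Nd; rewrite (convol_deg_le xN gN Nd) gt_eqF// -(subrr N).
rewrite dk (convol_coef k xN gN) subrr sub0r oppr_eq0.
under eq_bigr do rewrite gE.
case: k dk => [|k] _; first by rewrite big_ord1 subr0 /= divff.
rewrite big_ord_recl subn0 subr0 /= nth_rcons size_s ltnn eqxx.
rewrite mulrA mulrN divff// mulN1r.
apply/eqP; rewrite addrC subr_eq0; apply/eqP.
rewrite (reindex_inj rev_ord_inj) /=; apply: eq_bigr => j _.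
have jk : (j <= k)%N by rewrite -ltnS.
rewrite /bump leq0n add1n subSS -subSn//.
by rewrite subKn ?(s_stable j k)// ltnW.
Qed.

Definition invl x : laurent F := xget 0 [set y | y * x = 1].

Fact mulVl x : x != 0 -> invl x * x = 1.
Proof. by move=> /laurent_inv_subproof; apply: xgetPex. Qed.

Fact invl0 : invl 0 = 0.
Proof.
by apply: xgetPN => y /=; rewrite mulr0 => /esym/eqP; rewrite oner_eq0.
Qed.

HB.instance Definition _ :=
  GRing.ComNzRing_isField.Build (laurent F) mulVl invl0.

Fact polyl_subproof (p : {poly F}) :
  (fun d : int => if d is Posz k then p`_k else 0) \in @lbounded F.
Proof.
apply/lboundedP; exists (size p)%:Z => -[k|k]//; rewrite ltz_nat => pk.
by rewrite nth_default// ltnW.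
Qed.
(* The embedding F[z] -> F((z^-1)). *)
Definition polyl (p : {poly F}) : laurent F := Laurent (polyl_subproof p).

Definition polyv n (y : 'cV[{poly F}]_n) : 'cV[laurent F]_n := map_mx polyl y.

End LaurentField.

(* The topology of F((z^-1)) given by the degree valuation: a base of
   neighbourhoods of x consists of the sets {y | deg (y - x) < k}, k in Z. *)
Section LaurentTopology.
Variable F : fieldType.
Implicit Types x y : laurent F.

Definition lball x (k : int) : set (laurent F) :=
  [set y | forall d, k <= d -> (y - x) d = 0].

Definition lnbhs x : set_system (laurent F) := filter_from [set: int] (lball x).

HB.instance Definition _ := isPointed.Build (laurent F) 0.
HB.instance Definition _ := hasNbhs.Build (laurent F) lnbhs.

Lemma lball_refl x k : lball x k x.
Proof. by move=> d _; rewrite subrr. Qed.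

Lemma lball_trans x y w k : lball x k y -> lball y k w -> lball x k w.
Proof.
move=> xy yw d kd; rewrite -(subrK y w) -addrA lcoefD.
by rewrite (yw _ kd) (xy _ kd) addr0.
Qed.

Lemma lnbhs_filter x : ProperFilter (nbhs x).
Proof.
apply: filter_from_proper => [|k _]; last by exists x; apply: lball_refl.
apply: filter_from_filter => [|k l _ _]; first by exists 0.
exists (Order.min k l) => // y xy; split=> d kd; apply: xy.
  by rewrite ge_min kd.
by rewrite ge_min kd orbT.
Qed.

Lemma lnbhs_singleton x (A : set (laurent F)) : nbhs x A -> A x.
Proof. by move=> [k _]; apply; apply: lball_refl. Qed.

Lemma lnbhs_nbhs x (A : set (laurent F)) : nbhs x A -> nbhs x (nbhs^~ A).
Proof.
move=> [k _ kA]; exists k => // y xy; exists k => // w yw.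
exact/kA/(lball_trans xy).
Qed.

HB.instance Definition _ := Nbhs_isNbhsTopological.Build (laurent F)
  lnbhs_filter lnbhs_singleton lnbhs_nbhs.

End LaurentTopology.

(* F((z^-1))^n with the Borel sigma-algebra of the product topology. *)
Notation borel_laurent F n :=
  (g_sigma_algebraType (@open 'cV[laurent F]_n)).

Definition is_haar (R : realType) (F : fieldType) (n : nat)
    (mu : {measure set (borel_laurent F n) -> \bar R}) : Prop :=
  [/\ forall (v : 'cV[laurent F]_n) (B : set (borel_laurent F n)),
        measurable B -> mu [set v + x | x in (B : set 'cV[laurent F]_n)] = mu B,
      forall C : set 'cV[laurent F]_n, compact C -> (mu C < +oo)%E
    & forall U : set 'cV[laurent F]_n, open U -> U !=set0 -> (0 < mu U)%E].

Section Exponents.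
Variables (R : realType) (F : finFieldType).

Definition lnorm (x : laurent F) : R :=
  if x == 0 then 0 else #|F|%:R ^ ldeg x.

Definition vnorm n (v : 'cV[laurent F]_n) : R :=
  \big[Num.max/0]_(i < n) lnorm (v i 0).

(* |<v>|; the infimum is attained, since the values of vnorm lie in
   {0} U {q^d | d in Z}, without accumulation point other than 0, and only one
   polynomial vector is at distance < 1 from v. *)
Definition vdist n (v : 'cV[laurent F]_n) : R :=
  inf [set vnorm (v - polyv y) | y in [set: 'cV[{poly F}]_n]].

Definition is_solution n m (A : 'M[laurent F]_(n, m)) (theta : 'cV[laurent F]_n)
    (w H : R) (x : 'cV[{poly F}]_m) : Prop :=
  vdist (A *m polyv x - theta) <= H `^ (- w) /\ vnorm (polyv x) <= H.

Definition omega n m (A : 'M[laurent F]_(n, m)) (theta : 'cV[laurent F]_n) :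
    \bar R :=
  ereal_sup [set w%:E | w in [set w : R |
    forall H0 : R, exists2 H, H0 < H & exists x, is_solution A theta w H x]].

Definition omega_hat n m (A : 'M[laurent F]_(n, m))
    (theta : 'cV[laurent F]_n) : \bar R :=
  ereal_sup [set w%:E | w in [set w : R |
    exists H0 : R, forall H, H0 < H -> exists x, is_solution A theta w H x]].

Definition omega0 n m (A : 'M[laurent F]_(n, m)) : \bar R :=
  ereal_sup [set w%:E | w in [set w : R |
    forall H0 : R, exists2 H, H0 < H &
      exists2 x, x != 0 & is_solution A 0 w H x]].

Definition omega0_hat n m (A : 'M[laurent F]_(n, m)) : \bar R :=
  ereal_sup [set w%:E | w in [set w : R |
    exists H0 : R, forall H, H0 < H ->
      exists2 x, x != 0 & is_solution A 0 w H x]].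

End Exponents.

Arguments omega R {F n m} A theta.
Arguments omega_hat R {F n m} A theta.
Arguments omega0 R {F n m} A.
Arguments omega0_hat R {F n m} A.

(* Main.v *)
(* For integers a, b, the system "deg x < b, the first a coefficients of
   A x - theta after the point vanish" is a finite linear system over F_q with a
   block Hankel matrix, and the transposed matrix expresses "deg y < a, the first
   b coefficients of A^T y after the point vanish". Hence if the homogeneous
   system for A^T has only the trivial solution, the inhomogeneous one for A is
   solvable for every theta: this gives the two lower bounds.

   Conversely |<y.theta>| <= max(|x| |<A^T y>|, |y| |<A x - theta>|). For nonzero
   y_k, the set of theta with |<y_k.theta>| <= q^-(k+1) has density q^-k in each
   ball, so by Borel-Cantelli almost every theta is in finitely many of them; with
   y_k good homogeneous approximations for A^T of size about q^(k/delta), this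
   prevents A x - theta from being too small and gives the upper bounds.

   Last, along H = q^k consecutive solutions of the inhomogeneous system differ
   infinitely often, and their differences are homogeneous approximations. *)
From HB Require Import structures.
Require Import Defs.
From mathcomp Require Import all_boot all_order all_algebra.
From mathcomp Require Import all_classical all_reals all_analysis.
From mathcomp Require Import zify ring lra.

Set Implicit Arguments.
Unset Strict Implicit.
Unset Printing Implicit Defensive.

Import Order.TTheory GRing.Theory Num.Theory.

Local Open Scope classical_set_scope.
Local Open Scope ring_scope.

(** * Polynomials as a subring of Laurent series *)

Section PolynomialEmbedding.
Variable F : fieldType.
Implicit Types (p : {poly F}) (x y : laurent F) (d : int).

Lemma polyl_lt0 p d : d < 0 -> polyl p d = 0.
Proof. by case: d. Qed.

Lemma lcoef_sum (I : Type) (r : seq I) (P : pred I) (f : I -> laurent F) d :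
  (\sum_(i <- r | P i) f i) d = \sum_(i <- r | P i) f i d.
Proof. by elim/big_rec2: _ => [|i u v _ <-]; [exact: lcoef0|exact: lcoefD]. Qed.

(** The free bound [N] lets all coordinates of a polynomial vector share one range of summation. *)
Lemma lcoef_polylM N p x d : (size p <= N)%N ->
  (polyl p * x) d = \sum_(j < N) p`_j * x (d - j%:Z).
Proof.
move=> pN; pose r := [seq j%:Z | j <- iota 0 N].
have r_uniq : uniq r by rewrite map_inj_uniq ?iota_uniq// => i j [].
rewrite lcoefM -(@fsbig_widen _ _ _ _ [set` r]) //; last first.
  move=> [k|k] [_ /= kr]; last by rewrite mul0r.
  rewrite [X in X * _](_ : _ = p`_k)// nth_default ?mul0r//.
  apply: leq_trans pN _; rewrite leqNgt; apply/negP => kN.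
  by apply: kr; apply: map_f; rewrite mem_iota.
rewrite -fsbig_seq// big_map.
by rewrite -(big_mkord xpredT (fun j => p`_j * x (d - j%:Z))) /index_iota subn0.
Qed.

Fact polyl_zmod_morphism : zmod_morphism (@polyl F).
Proof.
move=> p s; apply/laurentP => -[k|k]; rewrite lcoefD lcoefN /= ?subr0//.
by rewrite coefB.
Qed.

Fact polyl_monoid_morphism : monoid_morphism (@polyl F).
Proof.
split=> [|p s].
  apply/laurentP => -[k|k]; rewrite lcoef1 //=.
  by rewrite coef1.
apply/laurentP => -[k|k].
  rewrite (@lcoef_polylM (maxn (size p) k.+1)) ?leq_maxl// [LHS](coefM p s k).
  rewrite (big_ord_widen _ (fun j => p`_j * s`_(k - j)) (leq_maxr (size p) k.+1)).
  rewrite big_mkcond; apply: eq_bigr => j _; case: ifPn => [jk|].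
    by rewrite (_ : Posz k - Posz j = Posz (k - j)%N)//; lia.
  rewrite -leqNgt => kj; rewrite polyl_lt0 ?mulr0//; lia.
rewrite (lcoef_polylM _ _ (leqnn _)) big1// => j _.
rewrite polyl_lt0 ?mulr0//; lia.
Qed.

HB.instance Definition _ :=
  GRing.isZmodMorphism.Build {poly F} (laurent F) (@polyl F) polyl_zmod_morphism.
HB.instance Definition _ :=
  GRing.isMonoidMorphism.Build {poly F} (laurent F) (@polyl F)
    polyl_monoid_morphism.

Lemma laurent_split x : exists p, forall d, 0 <= d -> (x - polyl p) d = 0.
Proof.
have [N xN] := laurent_deg_le x; exists (\poly_(k < `|N|.+1) x k%:Z) => -[k|//] _.
rewrite lcoefD lcoefN /= coef_poly; case: ltnP => [_|Nk]; first by rewrite subrr.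
rewrite xN ?subr0//; lia.
Qed.

End PolynomialEmbedding.

(** * Block Hankel matrices and their transposes *)

Section Duality.
Variables (F : fieldType) (n m : nat) (A : 'M[laurent F]_(n, m)).

Lemma lcoef_mul_polyv n' m' (B : 'M[laurent F]_(n', m')) N (x : 'cV[{poly F}]_m') i d :
  (forall k, (size (x k 0%R) <= N)%N) ->
  (B *m polyv x) i 0 d = \sum_k \sum_(j < N) (x k 0)`_j * B i k (d - j%:Z).
Proof.
move=> xN; rewrite mxE lcoef_sum; apply: eq_bigr => k _.
by rewrite mxE mulrC (lcoef_polylM _ _ (xN k)).
Qed.

(** With [X k j] read as the coefficient of z^j in the k-th unknown polynomial x_k, entry (i, l) is
    the coefficient of z^-(l+1) in (A x)_i. *)
Let hankel b a (X : 'M[F]_(m, b)) : 'M[F]_(n, a) :=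
  \matrix_(i, l) \sum_k \sum_(j < b) X k j * A i k (- l.+1%:Z - j%:Z).

Let hankel_linear b a : linear (@hankel b a).
Proof.
move=> c X Y; apply/matrixP => i l; rewrite !mxE mulr_sumr -big_split.
apply: eq_bigr => k _; rewrite mulr_sumr -big_split; apply: eq_bigr => j _ /=.
by rewrite !mxE mulrDl mulrA.
Qed.

Let mxvec_dot p q (M Y : 'M[F]_(p, q)) :
  (mxvec M *m (mxvec Y)^T) 0 0 = \sum_i \sum_j M i j * Y i j.
Proof.
rewrite mxE pair_bigA /= (reindex _ (curry_mxvec_bij p q)) /=.
by apply: eq_bigr => -[i j] _; rewrite mxE !mxvecE.
Qed.

(* Solvability of the truncated inhomogeneous system and uniqueness of the
   solution of the transposed homogeneous one are the surjectivity of a finite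
   block Hankel matrix and the injectivity of its transpose. *)
Lemma hankel_duality a b :
  (forall y : 'cV[{poly F}]_n, (forall i, (size (y i 0%R) <= a)%N) ->
    (forall k (l : 'I_b), (A^T *m polyv y) k 0 (- l.+1%:Z) = 0) -> y = 0) ->
  forall theta : 'cV[laurent F]_n, exists x : 'cV[{poly F}]_m,
    (forall k, (size (x k 0%R) <= b)%N) /\
    forall i (l : 'I_a), (A *m polyv x - theta) i 0 (- l.+1%:Z) = 0.
Proof.
move=> inj theta; pose f := GRing.isLinear.Build _ _ _ _ _ (@hankel_linear b a).
pose phi : {linear 'M[F]_(m, b) -> 'M[F]_(n, a)} := HB.pack (@hankel b a) f.
have full : row_full (lin_mx phi).
  (* Surjectivity is injectivity of the transpose: a kernel row, reshaped into a matrix [Y], gives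
     the coefficients of a solution y of the transposed system. *)
  rewrite /row_full -mxrank_tr -/(row_free _) -kermx_eq0; apply/eqP/row_matrixP => s.
  rewrite row0; set u := row s _.
  have : u *m (lin_mx phi)^T = 0 by apply/sub_kermxP/row_sub.
  move: u => u; rewrite -{1}(trmxK u) -trmx_mul => /(congr1 trmx).
  rewrite trmxK trmx0 -[u]vec_mxK; move: (vec_mx u) => Y LY.
  suff -> : Y = 0 by rewrite linear0.
  pose y : 'cV[{poly F}]_n := \col_i \poly_(l < a) nth 0 [seq Y i l | l : 'I_a] l.
  have yE i (l : 'I_a) : (y i 0)`_l = Y i l.
    by rewrite mxE coef_poly ltn_ord (nth_map l) ?size_enum_ord// nth_ord_enum.
  suff y0 : y = 0 by apply/matrixP => i l; rewrite -yE y0 !mxE coef0.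
  apply: inj => [i|k l]; first by rewrite mxE size_poly.
  rewrite (@lcoef_mul_polyv _ _ _ a) => [|i]; last by rewrite mxE size_poly.
  (* Pairing the kernel equation with the elementary matrix at (k, l) isolates one coordinate. *)
  have := congr1 (fun M : 'cV[F]_(m * b) => (delta_mx (0 : 'I_1) (mxvec_index k l) *m M) 0 0) LY.
  rewrite mulmx0 [RHS]mxE mulmxA -mxvec_delta mul_vec_lin mxvec_dot => dot0.
  rewrite -[RHS]dot0.
  apply: eq_bigr => i _; apply: eq_bigr => j _.
  rewrite yE mulrC; congr (_ * _); rewrite !mxE.
  (* The image of the elementary matrix has entries A_ik at degree -(j+l+1). The symmetry in j and l
     makes them the coefficients of the transposed system. *)
  rewrite (bigD1 k)//= (bigD1 l)//= mxE !eqxx mul1r !big1 ?addr0; last 2 first.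
  - by move=> k' /negPf kl; rewrite big1// => j' _; rewrite mxE kl mul0r.
  - by move=> j' /negPf jl; rewrite mxE jl andbF mul0r.
  by congr (A i k _); lia.
have /submxP[u uE] : (mxvec (\matrix_(i < n, l < a) theta i 0 (- l.+1%:Z)) <= lin_mx phi)%MS.
  exact: submx_full.
pose X := vec_mx u.
pose x : 'cV[{poly F}]_m := \col_k \poly_(j < b) nth 0 [seq X k j | j : 'I_b] j.
have xE k (j : 'I_b) : (x k 0)`_j = X k j.
  by rewrite mxE coef_poly ltn_ord (nth_map j) ?size_enum_ord// nth_ord_enum.
have xb k : (size (x k 0%R) <= b)%N by rewrite mxE size_poly.
exists x; split=> // i l; rewrite mxE lcoefD (lcoef_mul_polyv _ _ _ xb) mxE lcoefN.
apply/eqP; rewrite subr_eq0; apply/eqP.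
move: uE; rewrite -[u]vec_mxK mul_vec_lin => /(can_inj mxvecK)/matrixP/(_ i l).
rewrite !mxE => ->; apply: eq_bigr => k _; apply: eq_bigr => j _.
by rewrite xE.
Qed.

End Duality.

(** * Ultrametric norms and distance to the polynomial vectors *)

Section Norms.
Variables (R : realType) (F : finFieldType).
Implicit Types (x y : laurent F) (p : {poly F}) (r : R) (d : int).

Let q : R := #|F|%:R.

Lemma card_field_gt1 : 1 < q.
Proof. by rewrite ltr1n card_finNzRing_gt1. Qed.

Lemma lnorm_ge0 x : 0 <= lnorm R x.
Proof. by rewrite /lnorm; case: ifP => // _; apply: exprz_ge0. Qed.

Lemma lnorm_leP r x : 0 <= r ->
  lnorm R x <= r <-> forall d, x d != 0 -> q ^ d <= r.
Proof.
move=> r0; rewrite /lnorm; case: eqVneq => [->|x0].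
  by split=> // _ d; rewrite lcoef0 eqxx.
have [xd xN] := ldegP x0; split=> [xr d dx|]; last exact.
apply: le_trans xr; rewrite ler_eXz2l ?card_field_gt1// leNgt.
by apply: contraNN dx => dx; apply/eqP/xN.
Qed.

Lemma lnorm_ge x d : x d != 0 -> q ^ d <= lnorm R x.
Proof. by apply: (proj1 (lnorm_leP x (lnorm_ge0 x)) (lexx _)). Qed.

Lemma lnorm_le0 x : lnorm R x <= 0 -> x = 0.
Proof.
move=> x0; have [//|/ldegP[xd _]] := eqVneq x 0.
have := le_trans (lnorm_ge xd) x0; rewrite leNgt exprz_gt0//.
exact: lt_trans card_field_gt1.
Qed.

Lemma lnormD_le r x y : lnorm R x <= r -> lnorm R y <= r -> lnorm R (x + y) <= r.
Proof.
move=> xr yr; have r0 := le_trans (lnorm_ge0 x) xr.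
apply/lnorm_leP => // d; rewrite lcoefD; case: (eqVneq (x d) 0) => [->|xd _].
  by rewrite add0r => yd; apply: le_trans yr; apply: lnorm_ge.
by apply: le_trans xr; apply: lnorm_ge.
Qed.

Lemma lnormN x : lnorm R (- x) = lnorm R x.
Proof.
apply/eqP; rewrite eq_le; apply/andP; split; apply/lnorm_leP => [|d];
  rewrite ?lnorm_ge0// ?lcoefN => xd; apply: lnorm_ge; rewrite ?lcoefN ?oppr_eq0//.
by move: xd; rewrite oppr_eq0.
Qed.

Lemma lnormM_le x y : lnorm R (x * y) <= lnorm R x * lnorm R y.
Proof.
apply/lnorm_leP => [|d]; first by rewrite mulr_ge0 ?lnorm_ge0.
rewrite lcoefM => xy.
have [i [xi yi]] : exists i, x i != 0 /\ y (d - i) != 0.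
  apply: contrapT => nxy; move/eqP: xy; apply; apply: fsbig1 => i _.
  have [->|xi] := eqVneq (x i) 0; first by rewrite mul0r.
  have [->|yi] := eqVneq (y (d - i)) 0; first by rewrite mulr0.
  by case: nxy; exists i.
have q0 : q != 0 by rewrite gt_eqF// (lt_trans ltr01)// card_field_gt1.
rewrite -[d in _ ^ d](subrK i) addrC expfzDr//.
by rewrite ler_pM ?lnorm_ge// exprz_ge0.
Qed.

Lemma lnorm_coord_le n (v : 'cV[laurent F]_n) r i :
  vnorm R v <= r -> lnorm R (v i 0) <= r.
Proof. by apply: le_trans; rewrite /vnorm; apply: le_bigmax. Qed.

Lemma vnorm_leP n (v : 'cV[laurent F]_n) r : 0 <= r ->
  vnorm R v <= r <-> forall i, lnorm R (v i 0) <= r.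
Proof.
move=> r0; split=> [vr i|vr]; last by apply/bigmax_leP; split.
exact: lnorm_coord_le.
Qed.

Lemma vnorm_ge0 n (v : 'cV[laurent F]_n) : 0 <= vnorm R v.
Proof.
rewrite /vnorm; elim/big_ind: _ => // [x y x0 y0|i _]; last exact: lnorm_ge0.
by rewrite le_max x0.
Qed.

Lemma vnormB_le n r (v w : 'cV[laurent F]_n) :
  vnorm R v <= r -> vnorm R w <= r -> vnorm R (v - w) <= r.
Proof.
move=> vr wr; have r0 := le_trans (vnorm_ge0 v) vr.
apply/vnorm_leP => // i; rewrite !mxE lnormD_le ?lnormN//.
  exact: lnorm_coord_le.
exact: lnorm_coord_le.
Qed.

Lemma vdot_le n r s (u v : 'cV[laurent F]_n) :
  vnorm R u <= r -> vnorm R v <= s -> lnorm R ((u^T *m v) 0 0) <= r * s.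
Proof.
move=> ur vs; have r0 := le_trans (vnorm_ge0 u) ur.
have s0 := le_trans (vnorm_ge0 v) vs; rewrite mxE.
elim/big_ind: _ => [|x y|i _]; first 2 last.
- apply: le_trans (lnormM_le _ _) _; rewrite mxE ler_pM ?lnorm_ge0//.
    exact: lnorm_coord_le.
  exact: lnorm_coord_le.
- by rewrite /lnorm eqxx mulr_ge0.
- exact: lnormD_le.
Qed.

Lemma vnorm_polyv_leP n (y : 'cV[{poly F}]_n) (a : nat) :
  (forall i, (size (y i 0%R) <= a.+1)%N) -> vnorm R (polyv y) <= q ^+ a.
Proof.
move=> ya; have q0 : 0 <= q := ler0n _ _.
apply/vnorm_leP => [|i]; first exact: exprn_ge0.
apply/lnorm_leP => [|d]; first exact: exprn_ge0.
rewrite mxE; have [d0|d0] := ltP d 0; first by rewrite polyl_lt0 ?eqxx.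
case: d d0 => // k _ yk; rewrite -exprnP ler_weXn2l ?(ltW card_field_gt1)//.
rewrite -ltnS; apply: leq_trans (ya i); rewrite ltnNge; apply: contraNN yk => yk.
by rewrite /= nth_default.
Qed.

(* Subtracting the polynomial part of v is optimal, so the infimum defining
   vdist is attained. *)
Lemma vdist_coefP n (v : 'cV[laurent F]_n) r : 0 <= r ->
  vdist R v <= r <-> forall i d, d < 0 -> v i 0 d != 0 -> q ^ d <= r.
Proof.
move=> r0; have /choice[p pv] i := laurent_split (v i 0).
pose y0 : 'cV_n := \col_i p i.
have coefB (y : 'cV_n) i d : d < 0 -> (v - polyv y) i 0 d = v i 0 d.
  by move=> d0; rewrite 3!mxE lcoefD lcoefN polyl_lt0// subr0.
have y0min (y : 'cV_n) : vnorm R (v - polyv y0) <= vnorm R (v - polyv y).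
  apply/vnorm_leP => [|i]; first exact: vnorm_ge0.
  apply/lnorm_leP => [|d]; first exact: vnorm_ge0.
  have [d0|d0] := ltP d 0; last by rewrite 4!mxE pv// eqxx.
  rewrite coefB// => vd; have : (v - polyv y) i 0 d != 0 by rewrite coefB.
  by move=> /lnorm_ge /le_trans; apply; apply: lnorm_coord_le.
have -> : vdist R v = vnorm R (v - polyv y0).
  apply/eqP; rewrite eq_le; apply/andP; split.
    apply: ge_inf; last by exists y0.
    by exists 0 => _ [y _ <-]; exact: vnorm_ge0.
  by apply: lb_le_inf => [|_ [y _ <-]]; [exists (vnorm R (v - polyv y0)), y0|].
split=> [vr i d d0 vd|vr].
  apply: le_trans vr; rewrite -(coefB y0)// in vd.
  by apply: le_trans (lnorm_ge vd) _; apply: lnorm_coord_le.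
apply/vnorm_leP => // i; apply/lnorm_leP => // d.
have [d0|d0] := ltP d 0; first by rewrite coefB//; exact: vr.
by rewrite 4!mxE pv// eqxx.
Qed.

(** Removing polynomial parts realizes the infimum, so a bound on [vdist] has an exact witness,
    without any epsilon. *)
Lemma vdistP n (v : 'cV[laurent F]_n) r : 0 <= r ->
  vdist R v <= r <-> exists y : 'cV[{poly F}]_n, vnorm R (v - polyv y) <= r.
Proof.
move=> r0; split=> [/(vdist_coefP _ r0) vr|[y vr]].
  have /choice[p pv] i := laurent_split (v i 0).
  exists (\col_i p i); apply/vnorm_leP => // i; apply/lnorm_leP => // d.
  have [d0|d0] := ltP d 0; last by rewrite 4!mxE pv// eqxx.
  by rewrite 4!mxE lcoefD lcoefN polyl_lt0// subr0; apply: vr.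
apply: le_trans vr; apply: ge_inf; last by exists y.
by exists 0 => _ [z _ <-]; exact: vnorm_ge0.
Qed.

Lemma vdist_ge0 n (v : 'cV[laurent F]_n) : 0 <= vdist R v.
Proof.
apply: lb_le_inf; first by exists (vnorm R (v - polyv 0)), 0.
by move=> _ [y _ <-]; exact: vnorm_ge0.
Qed.

Lemma vdist_le1 n (v : 'cV[laurent F]_n) : vdist R v <= 1.
Proof.
apply/vdist_coefP => // i d d0 _; rewrite -[leRHS](expr0z q).
by rewrite ler_eXz2l ?card_field_gt1// ltW.
Qed.

Lemma vdistB_le n r (v w : 'cV[laurent F]_n) :
  vdist R v <= r -> vdist R w <= r -> vdist R (v - w) <= r.
Proof.
move=> vr wr; have r0 := le_trans (vdist_ge0 v) vr.
have /(vdistP _ r0)[y vy] := vr; have /(vdistP _ r0)[z wz] := wr.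
apply/vdistP => //; exists (y - z); rewrite /polyv map_mxB.
rewrite (_ : _ - _ = (v - polyv y) - (w - polyv z)); first exact: vnormB_le.
by rewrite !opprD !opprK addrACA.
Qed.

Lemma vdist_eq0 n (v : 'cV[laurent F]_n) :
  vdist R v = 0 -> exists y : 'cV[{poly F}]_n, v = polyv y.
Proof.
move=> v0; have /(vdistP _ (lexx 0))[y vy] : vdist R v <= 0 by rewrite v0.
exists y; apply/eqP; rewrite -subr_eq0; apply/eqP/matrixP => i j.
by rewrite ord1 [RHS]mxE; apply: lnorm_le0; exact: lnorm_coord_le vy.
Qed.

End Norms.

(** * Transference between a system and its transpose *)

Section Transference.
Variables (R : realType) (F : finFieldType).
Implicit Types (r H : R).

Let q : R := #|F|%:R.
Let q1 : 1 < q := card_field_gt1 R F.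
Let q0 : 0 < q := lt_trans ltr01 q1.

Lemma lt_card_field_exp r : exists N, r < q ^+ N.
Proof.
exists (Num.Def.archi_bound r); apply: lt_le_trans (upper_nthrootP (leqnn _)) _.
by rewrite lerXn2r ?nnegrE ?ler0n// ler_nat card_finNzRing_gt1.
Qed.

Lemma card_field_exp_bracket r : 1 <= r -> exists a, q ^+ a <= r < q ^+ a.+1.
Proof.
move=> r1; case: (ex_minnP (lt_card_field_exp r)) => -[|a] ra amin.
  by move: ra; rewrite expr0 ltNge r1.
exists a; rewrite ra andbT leNgt; apply/negP => /amin.
by rewrite ltnn.
Qed.

Lemma vdist_le_inv n (v : 'cV[laurent F]_n) a r : 0 < r -> r <= q ^+ a ->
  (forall i (l : 'I_a), v i 0 (- l.+1%:Z) = 0) -> vdist R v <= r^-1.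
Proof.
move=> r0 ra va; apply/vdist_coefP => [|i d d0 vd]; first by rewrite invr_ge0 ltW.
have [l dl] : exists l : nat, d = - l.+1%:Z by case: d d0 {vd} => // l _; exists l.
have al : (a <= l)%N.
  by rewrite leqNgt; apply: contraNN vd => la; rewrite dl (va i (Ordinal la)).
rewrite dl -invr_expz lef_pV2 ?posrE ?exprn_gt0//; apply: le_trans ra _.
by rewrite -exprnP ler_weXn2l ?(ltW q1)// leqW.
Qed.

(** Hankel duality for real bounds. Norms are 0 or powers of q, so rounding [r] and [s] down to q^a
    and q^b costs nothing. *)
Lemma inhomogeneous_solution n m (A : 'M[laurent F]_(n, m)) theta r s :
  1 <= r -> 1 <= s ->
  (forall y : 'cV[{poly F}]_n, y != 0 -> vnorm R (polyv y) <= r ->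
    s^-1 < vdist R (A^T *m polyv y)) ->
  exists x : 'cV[{poly F}]_m,
    vnorm R (polyv x) <= s /\ vdist R (A *m polyv x - theta) <= r^-1.
Proof.
move=> r1 s1 noy; have r0 := lt_le_trans ltr01 r1; have s0 := lt_le_trans ltr01 s1.
have [a /andP[ar ra]] := card_field_exp_bracket r1.
have [b /andP[bs sb]] := card_field_exp_bracket s1.
(* Size at most a+1 means norm at most q^a <= r, and a+1 vanishing digits mean distance below
   q^-(a+1) < r^-1; likewise for b and s. *)
have [|x [xb xa]] := @hankel_duality _ _ _ A a.+1 b.+1 _ theta.
  move=> y ya yb; apply/eqP; apply: contraT => y0.
  have := noy y y0 (le_trans (vnorm_polyv_leP R ya) ar).
  by rewrite ltNge (vdist_le_inv s0 (ltW sb)).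
exists x; split; first exact: le_trans (vnorm_polyv_leP R xb) bs.
exact: vdist_le_inv (ltW ra) _.
Qed.

(* The pairing is y^T theta = (A^T y)^T x - y^T (A x - theta), up to the
   polynomial contributions of the two nearest polynomial vectors. *)
Lemma pairing_le n m (A : 'M[laurent F]_(n, m)) theta
    (x : 'cV[{poly F}]_m) (y : 'cV[{poly F}]_n) r :
  vdist R (A^T *m polyv y) * vnorm R (polyv x) <= r ->
  vnorm R (polyv y) * vdist R (A *m polyv x - theta) <= r ->
  exists p, lnorm R (((polyv y)^T *m theta) 0 0 - polyl p) <= r.
Proof.
move=> yxr xyr.
have /(vdistP _ (vdist_ge0 _ _))[z zr] := lexx (vdist R (A^T *m polyv y)).
have /(vdistP _ (vdist_ge0 _ _))[w wr] := lexx (vdist R (A *m polyv x - theta)).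
exists ((z^T *m x - y^T *m w) 0 0).
set e := A^T *m polyv y - polyv z in zr.
set e' := A *m polyv x - theta - polyv w in wr.
have -> : ((polyv y)^T *m theta) 0 0 - polyl ((z^T *m x - y^T *m w) 0 0)
    = (e^T *m polyv x) 0 0 - ((polyv y)^T *m e') 0 0.
  transitivity (((polyv y)^T *m theta -
      ((polyv z)^T *m polyv x - (polyv y)^T *m polyv w)) 0 0).
    rewrite [RHS]mxE; congr (_ + _); rewrite [RHS]mxE; congr (- _).
    by rewrite /polyv !map_trmx -!map_mxM -map_mxB [RHS]mxE.
  transitivity ((e^T *m polyv x - (polyv y)^T *m e') 0 0); last first.
    by rewrite !mxE.
  congr (fun_of_matrix _ 0 0); rewrite /e /e' !mulmxBr [(_ - _)^T]linearB /= mulmxBl.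
  rewrite trmx_mul trmxK mulmxA.
  rewrite !opprB addrACA; set P := _ *m polyv x; set Q := _ *m theta.
  set S := _ *m polyv x; set T := _ *m polyv w.
  by rewrite addrC; apply/matrixP => i j; rewrite !mxE; ring.
apply: lnormD_le; rewrite ?lnormN.
  exact: le_trans (vdot_le zr (lexx _)) yxr.
exact: le_trans (vdot_le (lexx _) wr) xyr.
Qed.

End Transference.

(** * Nonnegativity of the exponents and inverses of extended reals *)

Section Exponents.
Variables (R : realType) (F : finFieldType).
Implicit Types (t w H : R).

Let q : R := #|F|%:R.
Let q1 : 1 < q := card_field_gt1 R F.
Let q0 : 0 < q := lt_trans ltr01 q1.

Lemma vnorm_polyv0 m : vnorm R (polyv (0 : 'cV[{poly F}]_m)) = 0.
Proof.
apply/eqP; rewrite eq_le vnorm_ge0 andbT; apply/vnorm_leP => // i.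
by rewrite !mxE raddf0 /lnorm eqxx.
Qed.

Lemma vnorm_polyv1 m : vnorm R (polyv (const_mx 1 : 'cV[{poly F}]_m)) <= 1.
Proof.
rewrite -(expr0 q); apply: vnorm_polyv_leP => i.
by rewrite mxE size_poly1.
Qed.

(** Exponent 0 is always admissible, since no vector is at distance more than 1 from the polynomial
    vectors; x = 0 serves here, and the constant vector 1 in the homogeneous case. *)
Lemma omega_ge0 n m (A : 'M[laurent F]_(n, m)) theta : (0 <= omega R A theta)%E.
Proof.
apply: ereal_sup_ubound; exists 0 => // H0; exists (`|H0| + 1).
  by rewrite (le_lt_trans (ler_norm _))// ltrDl.
exists 0; split; first by rewrite !oppr0 powRr0 vdist_le1.
by rewrite vnorm_polyv0 addr_ge0.
Qed.

Lemma omega_hat_ge0 n m (A : 'M[laurent F]_(n, m)) theta :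
  (0 <= omega_hat R A theta)%E.
Proof.
apply: ereal_sup_ubound; exists 0 => //; exists 0 => H H0.
exists 0; split; first by rewrite !oppr0 powRr0 vdist_le1.
by rewrite vnorm_polyv0 ltW.
Qed.

Lemma const1_neq0 m : (0 < m)%N -> (const_mx 1 : 'cV[{poly F}]_m) != 0.
Proof.
case: m => // m _; apply/eqP => /matrixP/(_ 0 0)/eqP.
by rewrite !mxE oner_eq0.
Qed.

Lemma omega0_ge0 n m (A : 'M[laurent F]_(n, m)) : (0 < m)%N -> (0 <= omega0 R A)%E.
Proof.
move=> m0; apply: ereal_sup_ubound; exists 0 => // H0; exists (`|H0| + 1).
  by rewrite (le_lt_trans (ler_norm _))// ltrDl.
exists (const_mx 1); first exact: const1_neq0.
split; first by rewrite !oppr0 powRr0 vdist_le1.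
by rewrite (le_trans (vnorm_polyv1 _))// lerDr.
Qed.

Lemma omega0_hat_ge0 n m (A : 'M[laurent F]_(n, m)) :
  (0 < m)%N -> (0 <= omega0_hat R A)%E.
Proof.
move=> m0; apply: ereal_sup_ubound; exists 0 => //; exists 1 => H H1.
exists (const_mx 1); first exact: const1_neq0.
split; first by rewrite !oppr0 powRr0 vdist_le1.
by rewrite (le_trans (vnorm_polyv1 _))// ltW.
Qed.

Lemma ereal_between (x y : \bar R) : (0 <= x)%E -> (x < y)%E ->
  exists t : R, (x < t%:E < y)%E.
Proof.
case: x => [x| |]//; case: y => [y| |]// x0 xy.
  by move: xy; rewrite lte_fin => xy; exists ((x + y) / 2); rewrite !lte_fin !midf_lt.
by exists (x + 1); rewrite lte_fin ltrDl ltr01 ltey.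
Qed.

(** Testing on reals above x also covers the endpoints: for x = 0 arbitrarily small t force y = +oo,
    and for x = +oo the inverse is 0. *)
Lemma inve_le_reals (x y : \bar R) : (0 <= x)%E -> (0 <= y)%E ->
  (forall t : R, 0 < t -> (x < t%:E)%E -> (t^-1%:E <= y)%E) -> (x^-1 <= y)%E.
Proof.
move=> x0 y0 xy; rewrite leNgt; apply/negP => yx.
have [s /andP[ys sx]] := ereal_between y0 yx.
have s0 : 0 < s by rewrite -lte_fin (le_lt_trans y0).
have sE : s%:E = (s^-1%:E)^-1%E by rewrite inver invr_eq0 gt_eqF// invrK.
have := xy s^-1; rewrite invr_gt0 invrK leNgt ys => /(_ s0) xs.
by move: sx xs; rewrite sE lte_pV2 ?inE ?lee_fin ?invr_ge0 ?(ltW s0)// => -> /(_ isT).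
Qed.

End Exponents.

(** * The inequalities valid for every theta, or for every theta outside the trivial set *)

Section ExponentInequalities.
Variables (R : realType) (F : finFieldType).
Implicit Types (t w H : R).

Let q : R := #|F|%:R.
Let q1 : 1 < q := card_field_gt1 R F.
Let q0 : 0 < q := lt_trans ltr01 q1.

Lemma powRVK H w : 0 <= H -> w != 0 -> (H `^ w) `^ w^-1 = H.
Proof. by move=> H0 w0; rewrite -powRrM mulfV// powRr1. Qed.

Lemma powR_ge1 H w : 1 <= H -> 0 <= w -> 1 <= H `^ w.
Proof. by move=> H1 w0; rewrite -[leLHS](powRr0 H) ler_powR. Qed.

Section InhomogeneousLowerBounds.
Variables (n m : nat) (A : 'M[laurent F]_(n, m)) (theta : 'cV[laurent F]_n).

(** Duality is applied with r = H and s = H^w; at height H^w the exponent 1/w asks for accuracy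
    exactly H^-1. *)
Let solution w H : 0 < w -> 1 <= H ->
  ~ (exists2 y, y != 0 & is_solution A^T 0 w H y) ->
  exists x, is_solution A theta w^-1 (H `^ w) x.
Proof.
move=> w0 H1 noy; have H0 := le_trans ler01 H1.
have [y y0 yH|x [xs xr]] := @inhomogeneous_solution R F n m A theta H (H `^ w) H1
    (powR_ge1 H1 (ltW w0)).
  rewrite -powRN ltNge; apply/negP => yw; apply: noy; exists y; first exact: y0.
  by split; rewrite ?subr0.
by exists x; split; rewrite // powRN powRVK// gt_eqF.
Qed.

(** For w above the uniform exponent, the transposed system fails at arbitrarily large H, and each
    failure gives an inhomogeneous solution at height H^w. *)
Lemma inv_omega0_hat_le (n_gt0 : (0 < n)%N) :
  ((omega0_hat R A^T)^-1 <= omega R A theta)%E.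
Proof.
apply: inve_le_reals => [||w w0 hw]; [exact: omega0_hat_ge0|exact: omega_ge0|].
apply: ereal_sup_ubound; exists w^-1 => // H0.
pose B := Num.max 1 H0; have B1 : 1 <= B by rewrite le_max lexx.
have : ~ exists H1, forall H, H1 < H ->
    exists2 y, y != 0 & is_solution A^T 0 w H y.
  by move=> hsol; move: hw; rewrite ltNge; apply/negP/negPn/ereal_sup_ubound; exists w.
(* The threshold B^(1/w) ensures H^w > B >= [H0]. *)
move=> /forallNP/(_ (B `^ w^-1))/existsNP[H /not_implyP[BH noy]].
have H1 : 1 <= H by rewrite (le_trans _ (ltW BH))// powR_ge1// invr_ge0 ltW.
have [x xH] := solution w0 H1 noy.
exists (H `^ w); last by exists x.
apply: (@le_lt_trans _ _ B); first by rewrite le_max lexx orbT.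
rewrite -[B](@powRVK _ w^-1) ?invr_eq0 ?gt_eqF ?(le_trans ler01)// invrK.
by rewrite gt0_ltr_powR// nnegrE ?powR_ge0// (le_trans ler01).
Qed.

(** For w above the ordinary exponent, the transposed system fails at every large height; the
    failure at H^(1/w) solves the inhomogeneous system at H. *)
Lemma inv_omega0_le (n_gt0 : (0 < n)%N) :
  ((omega0 R A^T)^-1 <= omega_hat R A theta)%E.
Proof.
apply: inve_le_reals => [||w w0 hw]; [exact: omega0_ge0|exact: omega_hat_ge0|].
apply: ereal_sup_ubound; exists w^-1 => //.
have : ~ forall H1, exists2 H, H1 < H &
    exists2 y, y != 0 & is_solution A^T 0 w H y.
  by move=> hsol; move: hw; rewrite ltNge; apply/negP/negPn/ereal_sup_ubound; exists w.
move=> /existsNP[H0 /forall2NP noy].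
pose B := Num.max 1 H0; have B1 : 1 <= B by rewrite le_max lexx.
exists (B `^ w) => H BH; have H0B : H0 <= B by rewrite le_max lexx orbT.
have H_ge0 : 0 <= H by rewrite (le_trans _ (ltW BH))// powR_ge0.
have BHw : B < H `^ w^-1.
  rewrite -[B](@powRVK _ w) ?gt_eqF ?(le_trans ler01)//.
  by rewrite gt0_ltr_powR ?invr_gt0// nnegrE ?powR_ge0.
have [x] : exists x, is_solution A theta w^-1 ((H `^ w^-1) `^ w) x.
  apply: solution => //; first exact: le_trans (ltW BHw).
  by have [/negP|//] := noy (H `^ w^-1); rewrite (le_lt_trans H0B).
have := @powRVK H w^-1 H_ge0; rewrite invrK => -> ; last by rewrite invr_eq0 gt_eqF.
by exists x.
Qed.

End InhomogeneousLowerBounds.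

Lemma omega_hat_le_omega0 n m (A : 'M[laurent F]_(n, m)) (theta : 'cV[laurent F]_n) :
  (0 < m)%N ->
  ~ (exists (x : 'cV[{poly F}]_m) (y : 'cV[{poly F}]_n),
       theta = A *m polyv x + polyv y) ->
  (omega_hat R A theta <= omega0 R A)%E.
Proof.
move=> m0 theta_out; apply: ge_ereal_sup => _ [w [H1 wsol] <-].
have [w0|w0] := leP w 0.
  by apply: le_trans (omega0_ge0 R A m0); rewrite lee_fin.
rewrite leNgt; apply/negP => Aw.
(* The gap between [s] and [w] will absorb the factor q between consecutive heights. *)
have [s /andP[As]] := ereal_between (omega0_ge0 R A m0) Aw; rewrite lte_fin => sw.
have s0 : 0 < s by rewrite -lte_fin (le_lt_trans (omega0_ge0 R A m0)).
move: As; rewrite ltNge => /negP; apply; apply: ereal_sup_ubound; exists s => // H0.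
have [K KH] := lt_card_field_exp F (Num.max H0 H1).
have qK k : (K <= k)%N -> Num.max H0 H1 < q ^+ k.
  by move=> Kk; apply: lt_le_trans KH _; rewrite ler_weXn2l// ltW.
have /choice[x xsol] k : exists x, (K <= k)%N -> is_solution A theta w (q ^+ k) x.
  case: (leqP K k) => [Kk|_]; last by exists 0.
  have [|x xs] := wsol (q ^+ k); last by exists x.
  by apply: le_lt_trans (qK k Kk); rewrite le_max lexx orbT.
(* For k >= s/(w-s) one has s(k+1) <= wk, that is q^(-kw) <= q^(-(k+1)s). *)
pose L := maxn K (Num.Def.archi_bound (s / (w - s))).
have KL : (K <= L)%N by rewrite leq_maxl.
have [k [Lk xk]] : exists k, (L <= k)%N /\ x k.+1 != x k.
  (* If the solutions were constant from [L] on, their common distance would be at most q^(-kw) for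
     all large k, hence 0, and theta would be in the excluded set. *)
  apply: contrapT => /forallNP nk; apply: theta_out.
  have xE k : (L <= k)%N -> x k = x L.
    move=> /subnK <-; elim: (k - L)%N => [//|j IH].
    rewrite addSn -[RHS]IH; apply/eqP; apply: contra_notT (nk (j + L)%N) => xj.
    by rewrite leq_addl.
  have small k : (L <= k)%N -> vdist R (A *m polyv (x L) - theta) <= (q ^+ k) `^ (- w).
    move=> Lk; rewrite -(xE _ Lk); exact: (xsol _ (leq_trans KL Lk)).1.
  exists (x L); suff /vdist_eq0[y yE] : vdist R (A *m polyv (x L) - theta) = 0.
    by exists (- y); rewrite /polyv map_mxN -/(polyv y) -yE opprB addrC subrK.
  apply/eqP; rewrite eq_le vdist_ge0 andbT leNgt; apply/negP.
  set v := vdist _ _ in small * => v0.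
  have [N Nv] := lt_card_field_exp F v^-1.
  pose k := maxn L (Num.Def.archi_bound (N%:R / w)).
  have := small k; rewrite leq_maxl => /(_ isT); rewrite leNgt => /negP; apply.
  rewrite powRN -[v]invrK ltf_pV2 ?posrE ?invr_gt0 ?powR_gt0 ?exprn_gt0//.
  apply: lt_le_trans Nv _; rewrite -!powR_mulrn ?(ltW q0)// -powRrM ler_powR ?(ltW q1)//.
  rewrite -ler_pdivrMr//; apply: le_trans (ltW (archi_boundP _)) _.
    by rewrite divr_ge0// ltW.
  by rewrite ler_nat leq_maxr.
have Kk := leq_trans KL Lk.
have [dk hk] := xsol _ Kk; have [dk1 hk1] := xsol _ (leqW Kk).
exists (q ^+ k.+1).
  by apply: le_lt_trans (qK _ (leqW Kk)); rewrite le_max lexx.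
exists (x k.+1 - x k); first by rewrite subr_eq0.
have qkS : q ^+ k <= q ^+ k.+1 by rewrite ler_weXn2l// ltW.
split; last first.
  by rewrite /polyv map_mxB; apply: vnormB_le; [exact: hk1|exact: le_trans hk qkS].
have -> : A *m polyv (x k.+1 - x k) - 0 =
    (A *m polyv (x k.+1) - theta) - (A *m polyv (x k) - theta).
  by rewrite subr0 opprB addrA subrK /polyv map_mxB mulmxBr.
(* By the ultrametric inequality the difference inherits the weaker bound, the one at height q^k. *)
apply: (@le_trans _ _ ((q ^+ k) `^ (- w))).
  apply: vdistB_le; [apply: le_trans dk1 _|exact: dk].
  rewrite !powRN lef_pV2 ?posrE ?powR_gt0 ?exprn_gt0//.
  by apply: ge0_ler_powR; rewrite ?nnegrE ?exprn_ge0 ?(ltW q0) ?(ltW w0).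
rewrite -!powR_mulrn ?(ltW q0)// -!powRrM ler_powR ?(ltW q1)//.
rewrite !mulrN lerN2 -natr1 mulrDl mul1r -lerBrDl -mulrBr -ler_pdivrMr ?subr_gt0//.
apply: le_trans (ltW (archi_boundP _)) _.
  by apply: divr_ge0; rewrite ?subr_ge0 ltW.
by rewrite ler_nat; apply: leq_trans Lk; rewrite leq_maxr.
Qed.

End ExponentInequalities.

(** * Topology of the Laurent space: compact cubes and open slices *)

Section LaurentSpace.
Variables (F : finFieldType) (n : nat).
Implicit Types (v w theta : 'cV[laurent F]_n) (y : 'cV[{poly F}]_n).

Lemma open_laurent (U : set 'cV[laurent F]_n) (k : int) :
  (forall v w, U v -> (forall i d, k <= d -> w i 0 d = v i 0 d) -> U w) -> open U.
Proof.
move=> Uk; rewrite openE => v Uv; exists (fun i j => lball (v i j) k).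
  by move=> i j; exists k.
move=> w wv; apply: (Uk v) => // i d kd.
by apply/eqP; rewrite -subr_eq0; apply/eqP/(wv i 0).
Qed.

(** These balls are compact, hence of finite Haar measure, and exhaust the space. *)
Definition lcube (j : nat) : set 'cV[laurent F]_n :=
  [set v : 'cV[laurent F]_n | forall i d, j%:Z <= d -> v i 0 d = 0].

Lemma lcube_cover v : exists j, lcube j v.
Proof.
have /choice[N vN] i := laurent_deg_le (v i 0).
exists (\max_i `|N i|%N).+1 => i d jd; apply: vN.
have : (`|N i| <= \max_i `|N i|)%N by apply: leq_bigmax.
lia.
Qed.

(** As F is finite, each coefficient is constant along an ultrafilter. These constants form the
    limit, because inside the cube a basic neighbourhood constrains only finitely many
    coefficients. *)
Lemma compact_lcube j : compact (lcube j).
Proof.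
rewrite compact_ultra => U UU Uj.
have /choice[c cE] (id : 'I_n * int) : exists a, U [set v : 'cV[laurent F]_n | v id.1 0 id.2 = a].
  apply: contrapT => /forallNP Ua.
  have : \near U, forall a, ~ (U : 'cV[laurent F]_n) id.1 0 id.2 = a.
    apply: filter_forall => a.
    by have [/Ua|] := in_ultra_setVsetC [set v : 'cV[laurent F]_n | v id.1 0 id.2 = a] UU.
  by move=> /filter_ex[v] /(_ _ erefl).
have c0 i d : j%:Z <= d -> c (i, d) = 0.
  move=> jd; have [v [/= <- vj]] := filter_ex (filterI (cE (i, d)) Uj).
  exact: vj.
have cb i : (fun d => c (i, d)) \in @lbounded F.
  by apply/lboundedP; exists j%:Z => d /ltW; apply: c0.
exists (\col_i Laurent (cb i)); split=> [i d jd|/=]; first by rewrite mxE /= c0.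
move=> W [P nbP PW]; apply: filterS PW _.
have : \near U, forall i, P i 0 ((U : 'cV[laurent F]_n) i 0).
  apply: filter_forall => i; have [k _ kP] := nbP i 0.
  have : \near U, forall l : 'I_`|j%:Z - k|,
      (U : 'cV[laurent F]_n) i 0 (k + l%:Z) = c (i, k + l%:Z).
    by apply: filter_forall => l; exact: cE (i, k + l%:Z).
  apply: filterS2 Uj => v vj vc; apply: kP => d kd.
  rewrite lcoefD lcoefN mxE /=; have [jd|dj] := leP j%:Z d.
    by rewrite vj// c0// subrr.
  have dl : (`|d - k| < `|j%:Z - k|)%N by lia.
  have := vc (Ordinal dl); rewrite /= (_ : k + _ = d); last by lia.
  move=> ->.
  by rewrite subrr.
by apply: filterS => v vP i l; rewrite ord1.
Qed.

Lemma polyl_eq0 (p : {poly F}) : polyl p = 0 -> p = 0.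
Proof.
move=> p0; apply/polyP => k.
by have := congr1 (fun x : laurent F => x k%:Z) p0; rewrite lcoef0 coef0.
Qed.

(** For c = 0 this is, within the cube, the event that y.theta is within q^-(a+1) of a polynomial;
    the other values of c give its translates. *)
Definition lslice j y a (c : 'I_a -> F) : set 'cV[laurent F]_n :=
  [set theta : 'cV[laurent F]_n | lcube j theta /\
    forall l : 'I_a, ((polyv y)^T *m theta) 0 0 (- l.+1%:Z) = c l].

Lemma open_lslice j y a c : open (@lslice j y a c).
Proof.
pose N := \max_i size (y i 0%R).
have yN i : (size (y i 0%R) <= N)%N by apply: leq_bigmax.
have coefE v (l : 'I_a) : ((polyv y)^T *m v) 0 0 (- l.+1%:Z) =
    \sum_i \sum_(k < N) (y i 0)`_k * v i 0 (- l.+1%:Z - k%:Z).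
  rewrite mxE lcoef_sum; apply: eq_bigr => i _.
  by rewrite !mxE (lcoef_polylM _ _ (yN i)).
apply: (@open_laurent _ (- (a + N)%:Z)) => v w [vj vc] wv; split.
  by move=> i d jd; rewrite wv ?vj//; lia.
move=> l; rewrite -vc !coefE; apply: eq_bigr => i _; apply: eq_bigr => k _.
rewrite wv//; have := ltn_ord l; have := ltn_ord k; lia.
Qed.

(** Divide the wanted series by a nonzero coordinate of y and drop the polynomial part of the
    quotient, which changes the product only by a polynomial. *)
Lemma pairing_surjective y a (c : 'I_a -> F) : y != 0 ->
  exists v, (forall i d, 0 <= d -> v i 0 d = 0) /\
    forall l : 'I_a, ((polyv y)^T *m v) 0 0 (- l.+1%:Z) = c l.
Proof.
move=> y0; have [i yi] : exists i, y i 0 != 0.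
  apply: contrapT => /forallNP yi; move/eqP: y0; apply; apply/matrixP => i j.
  by rewrite ord1 [RHS]mxE; apply/eqP/negP => /negP /yi.
pose cs d : F := if d is Negz l then nth 0 [seq c l | l : 'I_a] l else 0.
have csb : cs \in @lbounded F by apply/lboundedP; exists 0 => -[].
pose x := (polyl (y i 0))^-1 * Laurent csb.
have [p px] := laurent_split x.
exists (\col_i' if i' == i then x - polyl p else 0); split=> [i' d d0|l].
  by rewrite mxE; case: ifP => // _; rewrite px.
rewrite mxE (bigD1 i)// big1 => [|i' /negPf i'i]; last first.
  by rewrite [X in _ * X]mxE i'i mulr0.
rewrite lcoefD lcoef0 addr0 !mxE eqxx mulrBr mulrA divff ?mul1r; last first.
  by apply: contraNN yi => /eqP/polyl_eq0 ->.
rewrite -rmorphM lcoefD lcoefN polyl_lt0// subr0 /=.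
rewrite (nth_map l) ?size_enum_ord//.
by rewrite nth_ord_enum.
Qed.

End LaurentSpace.

(** * Haar measure of slices and the Borel-Cantelli argument *)

Section BorelCantelli.
Variables (R : realType) (F : finFieldType) (n : nat).
Variable mu : {measure set (borel_laurent F n) -> \bar R}.
Hypothesis mu_haar : is_haar mu.

Let q : R := #|F|%:R.
Let q1 : 1 < q := card_field_gt1 R F.
Let q0 : 0 < q := lt_trans ltr01 q1.

Lemma measurable_lslice j y a c :
  measurable (@lslice F n j y a c : set (borel_laurent F n)).
Proof. by apply: sub_sigma_algebra; exact: open_lslice. Qed.

Lemma measurable_lcube j : measurable (@lcube F n j : set (borel_laurent F n)).
Proof.
apply: sub_sigma_algebra; apply: (@open_laurent F n _ j%:Z) => v w vj wv i d jd.
by rewrite wv// vj.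
Qed.

(** The translating vector has only negative degrees, so it preserves the cube. *)
Lemma mu_lslice_translate j y a c : y != 0 ->
  mu (@lslice F n j y a c) = mu (@lslice F n j y a (fun=> 0)).
Proof.
move=> y0; have [v [v0 vc]] := pairing_surjective c y0.
case: mu_haar => /(_ v _ (measurable_lslice j y (fun=> 0))) <- _ _.
congr (mu _); apply/seteqP; split=> [theta [thj thc]|_ [theta [thj th0] <-]].
  exists (theta - v); last by rewrite addrC subrK.
  split=> [i d jd|l]; first by rewrite !mxE lcoefD lcoefN thj// v0 ?subr0//; lia.
  by rewrite mulmxBr mxE lcoefD thc mxE lcoefN vc subrr.
split=> [i d jd|l]; first by rewrite !mxE lcoefD thj// v0 ?addr0//; lia.
by rewrite mulmxDr mxE lcoefD vc th0 addr0.
Qed.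

(** The q^a slices, one for each c, are disjoint subsets of the cube with equal measure. *)
Lemma mu_lslice_le j y a : y != 0 ->
  ((q ^+ a)%:E * mu (@lslice F n j y a (fun=> 0%R)) <= mu (@lcube F n j))%E.
Proof.
move=> y0; pose N := #|{ffun 'I_a -> F}|.
pose S (i : 'I_N) : set (borel_laurent F n) := @lslice F n j y a (enum_val i).
have mS i : measurable (S i) by exact: measurable_lslice.
have qN : (q ^+ a)%:E = N%:R%:E :> \bar R.
  by rewrite /N card_ffun card_ord natrX.
rewrite qN mule_natl.
have -> : (mu (@lslice F n j y a (fun=> 0%R)) *+ N = \sum_(i < N) mu (S i))%E.
  rewrite (eq_bigr (fun=> mu (@lslice F n j y a (fun=> 0)))) => [|i _].
    by rewrite sumr_const card_ord.
  exact: mu_lslice_translate.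
rewrite -measure_bigsetU_ord//; last first.
  move=> i i' _ _ [theta [[_ thi] [_ thi']]]; apply: enum_val_inj.
  by apply/ffunP => l; rewrite -thi thi'.
apply: le_measure; rewrite ?inE; [exact: bigsetU_measurable|exact: measurable_lcube|].
by elim/big_ind: _ => [//|B C BS CS theta [/BS|/CS]//|i _ theta []].
Qed.

Lemma mu_lslice_lim_sup (y : nat -> 'cV[{poly F}]_n) j : (forall k, y k != 0) ->
  mu (lim_sup_set (fun k => @lslice F n j (y k) k (fun=> 0))) = 0.
Proof.
move=> y0; apply: lim_sup_set_cvg0 => [k|]; first exact: measurable_lslice.
have cub : (mu (@lcube F n j) < +oo)%E by case: mu_haar => _ + _; apply; exact: compact_lcube.
have [M M0 muM] : exists2 M : R, 0 <= M & mu (@lcube F n j) = M%:E.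
  exists (fine (mu (@lcube F n j))); first by rewrite fine_ge0.
  by rewrite fineK// ge0_fin_numE.
(* Since q >= 2, the k-th slice has measure at most M/2^k, written as 2M/2^(k+1) to fit
   [epsilon_trick0]. *)
apply: (@le_lt_trans _ _ (\sum_(k <oo) (M *+ 2 / (2 ^ k.+1)%:R)%:E)%E); last first.
  by apply: le_lt_trans (epsilon_trick0 _ _) _; rewrite ?mulrn_wge0// ltey.
apply: lee_nneseries => [k _ _|k _]; first exact: measure_ge0.
have := mu_lslice_le j k (y0 k); rewrite muM => muk.
have -> : M *+ 2 / (2 ^ k.+1)%:R = (2 ^+ k)^-1 * M.
  by rewrite natrX exprS; field; rewrite expf_neq0.
rewrite EFinM lee_pdivlMl ?exprn_gt0//; apply: le_trans muk.
rewrite lee_wpmul2r// lee_fin lerXn2r ?nnegrE ?(ltW q0)//.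
by rewrite ler_nat card_finNzRing_gt1.
Qed.

Lemma ae_pairing_gt (y : nat -> 'cV[{poly F}]_n) : (forall k, y k != 0) ->
  {ae mu, forall theta : 'cV[laurent F]_n, exists K, forall k, (K <= k)%N ->
    forall p, q ^- k.+1 < lnorm R (((polyv (y k))^T *m theta) 0 0 - polyl p)}.
Proof.
move=> y0; pose bad j : set (borel_laurent F n) :=
  lim_sup_set (fun k => @lslice F n j (y k) k (fun=> 0)).
apply: (@negligibleS _ _ _ _ (\bigcup_j bad j)); last first.
  apply: negligible_bigcup => j; exists (bad j); split=> //.
    apply: bigcap_measurable => // k _; apply: bigcup_measurable => i _.
    exact: measurable_lslice.
  exact: mu_lslice_lim_sup.
move=> theta /= /forallNP bad_theta; have [j thj] := lcube_cover theta.
exists j => // K _; have /existsNP[k /not_implyP[Kk /existsNP[p /negP]]] := bad_theta K.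
rewrite -leNgt => thp; exists k => //; split=> // l; apply/eqP; apply: contraT => thl.
(* A nonzero digit at -(l+1) with l < k would keep theta's pairing at distance at least q^-(l+1) >
   q^-(k+1) from every polynomial. *)
have : ((polyv (y k))^T *m theta) 0 0 (- l.+1%:Z) - polyl p (- l.+1%:Z) != 0.
  by rewrite polyl_lt0// subr0.
rewrite -lcoefN -lcoefD => /(lnorm_ge R)/le_trans/(_ thp).
rewrite -invr_expz lef_pV2 ?posrE ?exprn_gt0// ?exprz_gt0// -exprnP.
by rewrite ler_eXn2l// ltnS leqNgt ltn_ord.
Qed.

End BorelCantelli.

(** * Upper bounds for almost every theta *)

Section GenericExponents.
Variables (R : realType) (F : finFieldType) (n m : nat).
Hypothesis n_gt0 : (0 < n)%N.
Variables (A : 'M[laurent F]_(n, m)) (mu : {measure set (borel_laurent F n) -> \bar R}).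
Hypothesis mu_haar : is_haar mu.

Let q : R := #|F|%:R.
Let q1 : 1 < q := card_field_gt1 R F.
Let q0 : 0 < q := lt_trans ltr01 q1.

(* Typeclass resolution does not find this instance by itself: theta is quantified
   over 'cV[laurent F]_n rather than over borel_laurent F n. *)
Let ae_filter : Filter (nbhs (almost_everywhere mu)).
Proof. exact: ae_filter_ringOfSetsType. Qed.

(** With h = [h k], a solution x would bound both terms of the pairing by h^-delta, as h^-w
    h^(w-delta) and h h^-(1+delta). The growth of h makes this at most q^-(k+1), against
    Borel-Cantelli. *)
Lemma ae_no_solution (w delta : R) (h : nat -> R) K0 : 0 < delta ->
  (forall k, q `^ (k.+1%:R / delta) <= h k) ->
  (forall k, (K0 <= k)%N -> exists2 y, y != 0 & is_solution A^T 0 w (h k) y) ->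
  {ae mu, forall theta : 'cV[laurent F]_n, exists K, forall k, (K <= k)%N ->
    forall x, vnorm R (polyv x) <= h k `^ (w - delta) ->
      h k `^ (- (1 + delta)) < vdist R (A *m polyv x - theta)}.
Proof.
move=> d0 hq sol.
have /choice[y yP] k : exists y, y != 0 /\ ((K0 <= k)%N -> is_solution A^T 0 w (h k) y).
  case: (leqP K0 k) => [/sol[y y0 ys]|_]; first by exists y.
  (* Below [K0] any nonzero vector will do to complete the sequence. *)
  by exists (const_mx 1); split=> //; exact: const1_neq0.
have h0 k : 0 < h k by apply: lt_le_trans (hq k); exact: powR_gt0.
have := ae_pairing_gt mu_haar (fun k => (yP k).1); apply: (@filterS _ _ ae_filter).
move=> theta [K thK]; exists (maxn K K0) => k; rewrite geq_max => /andP[Kk K0k] x xh.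
rewrite ltNge; apply/negP => thx.
have [yd yh] := (yP k).2 K0k; rewrite subr0 in yd.
have [||p] := @pairing_le R F n m A theta x (y k) (h k `^ (- delta)).
- apply: le_trans (ler_pM _ _ yd xh) _; rewrite ?vdist_ge0 ?vnorm_ge0//.
  rewrite -powRD; last by rewrite (gt_eqF (h0 k)) implybT.
  by rewrite addrA addNr add0r.
- apply: le_trans (ler_pM _ _ yh thx) _; rewrite ?vdist_ge0 ?vnorm_ge0//.
  rewrite -[X in X * _]powRr1 ?(ltW (h0 k))// -powRD; last by rewrite (gt_eqF (h0 k)) implybT.
  by rewrite opprD addrA subrr add0r.
apply/negP; rewrite -ltNge; apply: le_lt_trans (thK k Kk p).
rewrite powRN lef_pV2 ?posrE ?powR_gt0 ?exprn_gt0//.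
have -> : q ^+ k.+1 = (q `^ (k.+1%:R / delta)) `^ delta.
  by rewrite -powRrM divfK ?gt_eqF// powR_mulrn// ltW.
apply: ge0_ler_powR; rewrite ?nnegrE ?powR_ge0 ?(ltW d0) ?(ltW (h0 k))//.
Qed.

(** This delta makes the excluded accuracy h^-(1+delta) equal to H^-t at height H = h^(w-delta). *)
Let exists_delta (t w : R) : 0 < t -> t^-1 < w -> exists2 d, 0 < d < w & 1 + d = t * (w - d).
Proof.
move=> t0 tw; have tw1 : 1 < t * w by rewrite mulrC -ltr_pdivrMr// div1r.
have w0 : 0 < w by apply: lt_trans tw; rewrite invr_gt0.
have t1 : 0 < 1 + t by rewrite addr_gt0.
exists ((t * w - 1) / (1 + t)); last by field; rewrite gt_eqF.
rewrite divr_gt0 ?subr_gt0//= ltr_pdivrMr//; lra.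
Qed.

Let large_exponent (e H : R) : 0 < e -> exists k0, forall k, (k0 <= k)%N ->
  H < q `^ (k.+1%:R * e).
Proof.
move=> e0; have [N NH] := lt_card_field_exp F H.
exists (Num.Def.archi_bound (N%:R / e)) => k Nk; apply: lt_le_trans NH _.
rewrite -powR_mulrn ?(ltW q0)// ler_powR ?(ltW q1)// -ler_pdivrMr//.
apply: le_trans (ltW (archi_boundP _)) _; first by rewrite divr_ge0// ltW.
by rewrite ler_nat ltnW.
Qed.

Let lt_inve_real (t : R) (x : \bar R) : (0 <= x)%E -> (x^-1 < t%:E)%E ->
  0 < t /\ (t^-1%:E < x)%E.
Proof.
move=> x0 xt; have t0 : 0 < t by rewrite -lte_fin (le_lt_trans _ xt)// inve_ge0.
split=> //; have := xt; rewrite inve_plt ?inE ?lee_fin ?(ltW t0)//.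
by rewrite inver gt_eqF.
Qed.

(** The transposed system is solvable only along some unbounded sequence [h k]; this obstructs the
    inhomogeneous one at unboundedly many heights, enough for the uniform exponent. *)
Lemma ae_omega_hat_le (t : R) : ((omega0 R A^T)^-1 < t%:E)%E ->
  {ae mu, forall theta : 'cV[laurent F]_n, (omega_hat R A theta <= t%:E)%E}.
Proof.
move=> /(lt_inve_real (omega0_ge0 R A^T n_gt0))[t0 /ereal_sup_gt[_ [w wsol <-]]].
rewrite lte_fin => /(exists_delta t0)[d /andP[d0 dw] dE].
have /choice[h hP] k : exists H, q `^ (k.+1%:R / d) < H /\
    exists2 y, y != 0 & is_solution A^T 0 w H y.
  by have [H qH ysol] := wsol (q `^ (k.+1%:R / d)); exists H.
have hq k : q `^ (k.+1%:R / d) <= h k by apply: ltW; case: (hP k).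
have := @ae_no_solution w d h 0 d0 hq (fun k _ => (hP k).2).
apply: (@filterS _ _ ae_filter) => theta [K thK]; apply: ge_ereal_sup => _ [v [H1 vsol] <-].
rewrite lee_fin leNgt; apply/negP => tv.
have e0 : 0 < (w - d) / d by rewrite divr_gt0// subr_gt0.
have [k1 k1P] := large_exponent H1 e0.
pose k := maxn K k1; pose H := h k `^ (w - d).
have qH : q `^ (k.+1%:R * ((w - d) / d)) <= H.
  rewrite mulrA mulrAC powRrM; apply: ge0_ler_powR; rewrite ?nnegrE ?powR_ge0//.
    by rewrite subr_ge0 ltW.
  by apply: le_trans (hq k); exact: powR_ge0.
have [|x [xd xH]] := vsol H.
  by apply: lt_le_trans qH; apply: k1P; rewrite leq_maxr.
have := thK k (leq_maxl _ _) x xH; rewrite ltNge => /negP; apply.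
apply: le_trans xd _; rewrite dE [t * _]mulrC -mulrN powRrM -/H ler_powR ?lerN2 ?(ltW tv)//.
apply: le_trans qH; apply: powR_ge1; first exact: ltW.
by rewrite mulr_ge0 ?divr_ge0 ?subr_ge0 ?(ltW d0) ?(ltW dw).
Qed.

(** The transposed system is now solvable at all large heights, so [h] can be geometric and every
    large H lies between consecutive obstructed heights. *)
Lemma ae_omega_le (t : R) : ((omega0_hat R A^T)^-1 < t%:E)%E ->
  {ae mu, forall theta : 'cV[laurent F]_n, (omega R A theta <= t%:E)%E}.
Proof.
move=> /(lt_inve_real (omega0_hat_ge0 R A^T n_gt0))[t0 /ereal_sup_gt[_ [w [H0 wsol] <-]]].
rewrite lte_fin => /(exists_delta t0)[d /andP[d0 dw] dE].
pose h k := q `^ (k.+1%:R / d).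
have dV0 : 0 < d^-1 by rewrite invr_gt0.
have [K0 K0P] := large_exponent H0 dV0.
have := @ae_no_solution w d h K0 d0 (fun k => lexx _) (fun k K0k => wsol _ (K0P k K0k)).
apply: (@filterS _ _ ae_filter) => theta [K thK]; apply: ge_ereal_sup => _ [v vsol <-].
rewrite lee_fin leNgt; apply/negP => tv.
set e := (w - d) / d; have e0 : 0 < e by rewrite divr_gt0// subr_gt0.
have hE k : h k `^ (w - d) = q `^ (k.+1%:R * e).
  by rewrite -powRrM /e mulrA mulrAC.
(* Beyond t/(v-t) one has t(k+2) <= v(k+1), so v > t absorbs the rounding of H up to the next
   obstructed height. *)
pose K1 := maxn K (Num.Def.archi_bound (t / (v - t))).
have [H K1H [x [xd xH]]] := vsol (q `^ (K1.+1%:R * e)).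
have exk : exists k, H <= q `^ (k.+1%:R * e).
  by have [k kP] := large_exponent H e0; exists k; apply: ltW; exact: kP.
(* The least obstructed height above H; minimality puts the preceding one below H. *)
case: (ex_minnP exk) => k Hk kmin.
have K1k : (K1 < k)%N.
  rewrite ltnNge; apply/negP => kK1; move: K1H; rewrite ltNge => /negP; apply.
  by apply: le_trans Hk _; rewrite ler_powR ?(ltW q1)// ler_pM2r// ler_nat ltnS.
case: k => // k in Hk kmin K1k *.
have kH : q `^ (k.+1%:R * e) < H.
  by rewrite ltNge; apply/negP => /kmin; rewrite ltnn.
have := thK k.+1 (leq_trans (leq_maxl _ _) (ltnW K1k)) x.
rewrite hE => /(_ (le_trans xH Hk)); rewrite ltNge => /negP; apply.
apply: le_trans xd _; rewrite !powRN.
have Hgt0 : 0 < H by apply: le_lt_trans kH; exact: powR_ge0.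
rewrite lef_pV2 ?posrE ?powR_gt0//.
apply: (@le_trans _ _ ((q `^ (k.+1%:R * e)) `^ v)); last first.
  apply: ge0_ler_powR; rewrite ?nnegrE ?powR_ge0 ?(ltW Hgt0) ?(ltW kH)//.
  by rewrite ltW// (lt_trans t0).
rewrite -!powRrM ler_powR ?(ltW q1)// dE.
have -> : k.+2%:R / d * (t * (w - d)) = k.+2%:R * t * e by rewrite /e; ring.
rewrite [leRHS]mulrAC ler_pM2r//.
rewrite -natr1 mulrDl mul1r -lerBrDl -mulrBr -ler_pdivrMr ?subr_gt0//.
apply: le_trans (ltW (archi_boundP _)) _.
  by apply: divr_ge0; rewrite ?subr_ge0 ltW.
by rewrite ler_nat; apply: leq_trans (ltnW K1k); exact: leq_maxr.
Qed.

(** The null set depends on t, so t is restricted to the countable family x + 1/(k+1). *)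
Lemma ae_le_of_lt (x : \bar R) (f : 'cV[laurent F]_n -> \bar R) : (0 <= x)%E ->
  (forall t : R, (x < t%:E)%E ->
    {ae mu, forall theta : 'cV[laurent F]_n, (f theta <= t%:E)%E}) ->
  {ae mu, forall theta : 'cV[laurent F]_n, (f theta <= x)%E}.
Proof.
case: x => [x| |]// _ xt; last by apply: aeW => theta; rewrite leey.
have /ae_foralln : forall k : nat, {ae mu, forall theta : 'cV[laurent F]_n,
    (f theta <= (x + k.+1%:R^-1)%:E)%E}.
  by move=> k; apply: xt; rewrite lte_fin ltrDl invr_gt0 ltr0n.
apply: (@filterS _ _ ae_filter) => theta fk; apply/lee_addgt0Pr => e e0.
apply: le_trans (fk (Num.Def.archi_bound e^-1)) _.
rewrite -EFinD lee_fin lerD2l invf_ple ?posrE ?invr_gt0 ?ltr0n//.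
apply: le_trans (ltW (archi_boundP _)) _; first by rewrite invr_ge0 ltW.
by rewrite ler_nat.
Qed.

End GenericExponents.

Theorem theorem1p2 (R : realType) (F : finFieldType) (m n : nat)
    (m_gt0 : (0 < m)%N) (n_gt0 : (0 < n)%N) (A : 'M[laurent F]_(n, m)) :
  [/\ forall theta : 'cV[laurent F]_n,
        ((omega0_hat R A^T)^-1 <= omega R A theta)%E /\
        ((omega0 R A^T)^-1 <= omega_hat R A theta)%E,
      forall mu : {measure set (borel_laurent F n) -> \bar R}, is_haar mu ->
        {ae mu, forall theta : 'cV[laurent F]_n,
          omega R A theta = ((omega0_hat R A^T)^-1)%E /\
          omega_hat R A theta = ((omega0 R A^T)^-1)%E}
    & forall theta : 'cV[laurent F]_n,
        ~ (exists (x : 'cV[{poly F}]_m) (y : 'cV[{poly F}]_n),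
             theta = A *m polyv x + polyv y) ->
        (omega_hat R A theta <= omega0 R A)%E].
Proof.
split=> [theta|mu mu_haar|theta]; last exact: omega_hat_le_omega0.
  by split; [exact: inv_omega0_hat_le|exact: inv_omega0_le].
have := ae_le_of_lt _ (ae_omega_hat_le n_gt0 mu_haar (A := A)).
have := ae_le_of_lt _ (ae_omega_le n_gt0 mu_haar (A := A)).
rewrite !inve_ge0 omega0_ge0// omega0_hat_ge0// => /(_ isT) + /(_ isT).
apply: (@filterS2 _ _ (ae_filter_ringOfSetsType mu)) => theta le_om le_hat.
split; apply/eqP; rewrite eq_le.
  by rewrite le_om inv_omega0_hat_le.
by rewrite le_hat inv_omega0_le.
Qed.
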